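(* Let $k \geq 2$ be an integer and let $\{F_n(k)\}_{n \geq 0}$ be any sequence of complex numbers satisfying $F_n(k) = F_{n-1}(k) + F_{n-2}(k) + \dots + F_{n-k}(k)$ for all $n \geq k$. Then for all $n \geq k$, $$F_n(k) = - F_k(k) \sum_{i=1}^{\lfloor \frac{n+1}{k+1} \rfloor} (-1)^i \binom{n-ik}{i-1} 2^{n+1-i(k+1)} + \sum_{j=0}^{k-1} \sum_{i=1}^{\lfloor \frac{n-j}{k+1} \rfloor} (-1)^i F_j(k) \binom{n-j-1-ik}{i-1} 2^{n-j-i(k+1)}.$$
   Context: Empty sums are $0$. *)

(* Defs.v *)
From HB Require Import structures.
From mathcomp Require Export all_boot all_order all_algebra.
From mathcomp Require Export reals.
From mathcomp Require Export complex.
Set Implicit Arguments.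
Unset Strict Implicit.
Unset Printing Implicit Defensive.

(* A realType is the field of real numbers up to isomorphism, so R[i] is the
   field of complex numbers.  Since k <= n, the subtraction n - i never
   truncates. *)
Definition kbonacci_recurrence (R : realType) (k : nat) (F : nat -> R[i]%C) : Prop :=
  forall n : nat, (k <= n)%N ->
    F n = (\sum_(1 <= i < k.+1) F (n - i)%N)%R.

(* Main.v *)
Require Import Defs.
From mathcomp Require Import all_boot all_order all_algebra.
From mathcomp Require Import reals complex.
From mathcomp Require Import zify ring.
Set Implicit Arguments.
Unset Strict Implicit.
Unset Printing Implicit Defensive.
Import Order.TTheory GRing.Theory Num.Theory.
Local Open Scope ring_scope.
Local Open Scope complex_scope.

(* Subtracting consecutive instances of the recurrence gives
   F (n + 1) = 2 F n - F (n - k) for n >= k.  The numbers a_m with generating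
   function 1 / (1 - 2 x + x ^ (k + 1)), expanded as a geometric series in
   2 x - x ^ (k + 1), solve this three-term recurrence, and the formula is the
   combination of their shifts matching the initial values F 0, ..., F k. *)

Section FundamentalSolution.
Variables (K : comNzRingType) (k : nat).

(** The [x^m] part of [(2 x - x^(k+1))^(m - i k)]: [i] of the factors contribute [-x^(k+1)], the
    others [2 x]. *)
Definition fund_term (m i : nat) : K :=
  (-1) ^+ i * ('C(m - i * k, i))%:R * 2 ^+ (m - i * k.+1).

Definition fund (m : nat) : K := \sum_(0 <= i < (m %/ k.+1).+1) fund_term m i.

(* The truncated subtractions are harmless: the binomial coefficient vanishes
   as soon as they may truncate. *)
Lemma fund_term_eq0 (m i : nat) : (m < i * k.+1)%N -> fund_term m i = 0.
Proof.
move=> lt_m; rewrite /fund_term bin_small ?mulr0 ?mul0r //.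
by case: i lt_m => [|i]; lia.
Qed.

Lemma fund_widen (m N : nat) :
  (m %/ k.+1 < N)%N -> fund m = \sum_(0 <= i < N) fund_term m i.
Proof.
move=> ltN; rewrite [RHS](big_cat_nat (n := (m %/ k.+1).+1)) //=.
rewrite [X in _ + X]big_nat [X in _ + X]big1 ?addr0 // => i /andP[lti _].
by apply: fund_term_eq0; rewrite -ltn_divLR.
Qed.

Lemma fund_term0 (m : nat) : fund_term m 0 = 2 ^+ m.
Proof. by rewrite /fund_term bin0 expr0 !mul1r mul0n subn0. Qed.

Lemma fund_le (m : nat) : (m <= k)%N -> fund m = 2 ^+ m.
Proof. by move=> lemk; rewrite /fund divn_small // big_nat1 fund_term0. Qed.

(** Pascal's rule, with a factor [2] split off the power. *)
Lemma fund_termS (m i : nat) : (0 < k)%N -> (k <= m)%N ->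
  fund_term m.+1 i.+1 = 2 * fund_term m i.+1 - fund_term (m - k) i.
Proof.
move=> k_gt0 lekm.
have [lt_m|le_m] := ltnP m.+1 (i.+1 * k.+1).
  by rewrite !fund_term_eq0 ?mulr0 ?subr0 //; lia.
rewrite /fund_term.
have -> : (m.+1 - i.+1 * k = (m - i.+1 * k).+1)%N by nia.
have -> : (m - k - i * k = m - i.+1 * k)%N by lia.
have -> : (m - k - i * k.+1 = m.+1 - i.+1 * k.+1)%N by lia.
rewrite binS natrD exprS; move: le_m; rewrite leq_eqVlt => /orP[/eqP eq_m|lt_m].
  (* Here [m - (i+1) k = i]: the exponent of [2] in [fund_term m i.+1] truncates, but the binomial
     coefficient is zero. *)
  rewrite (@bin_small _ i.+1); last by nia.
  ring.
have -> : (m.+1 - i.+1 * k.+1 = (m - i.+1 * k.+1).+1)%N by lia.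
rewrite exprS; ring.
Qed.

Lemma fundS (m : nat) : (0 < k)%N -> (k <= m)%N ->
  fund m.+1 = 2 * fund m - fund (m - k).
Proof.
move=> k_gt0 lekm.
have lt_div p : (p <= m.+1)%N -> (p %/ k.+1 < m.+2)%N.
  by move=> le_p; rewrite ltnS (leq_trans (leq_div _ _)).
rewrite (@fund_widen m.+1 m.+3) ?(@fund_widen m m.+3) ?(@fund_widen (m - k) m.+2);
  try by [apply: lt_div; lia | apply: ltnW; apply: lt_div; lia].
rewrite !(big_nat_recl m.+2) //= !fund_term0 exprS mulrDr -addrA; congr (_ + _).
rewrite mulr_sumr -sumrB; apply: eq_bigr => i _.
exact: fund_termS.
Qed.

(* Both inner sums of the formula are values of [coef], at [n.+1] and [n - j]. *)
Definition coef (s : nat) : K :=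
  \sum_(1 <= i < (s %/ k.+1).+1)
    (-1) ^+ i * ('C(s - 1 - i * k, i - 1))%:R * 2 ^+ (s - i * k.+1).

Lemma coef_le (s : nat) : (s <= k)%N -> coef s = 0.
Proof. by move=> lesk; rewrite /coef divn_small // big_geq. Qed.

Lemma coef_fund (m : nat) : coef (m + k.+1) = - fund m.
Proof.
rewrite /coef -[X in ((m + X) %/ _)%N]mul1n [X in (X %/ _)%N]addnC.
rewrite divnMDl // add1n big_add1 /= /fund -sumrN.
apply: eq_bigr => i _; rewrite /fund_term exprS [(i.+1 - 1)%N]subn1.
have -> : (m + k.+1 - 1 - i.+1 * k = m - i * k)%N by lia.
have -> : (m + k.+1 - i.+1 * k.+1 = m - i * k.+1)%N by lia.
ring.
Qed.

(** The generating function of [coef] is [-x^(k+1) / (1 - 2 x + x^(k+1))]; the indicator comes from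
    its numerator. *)
Lemma coefS (s : nat) : (0 < k)%N ->
  coef s.+1 = 2 * coef s - coef (s - k) - (s == k)%:R.
Proof.
move=> k_gt0; have [lt_sk|lt_ks|->] := ltngtP s k.
- by rewrite !coef_le ?mulr0 ?subr0 //; lia.
- have [m ->] : exists m, s = (m + k.+1)%N by exists (s - k.+1)%N; lia.
  rewrite -addSn !coef_fund subr0.
  (* For [m < k], [fundS] does not apply, but both values of [fund] are powers of [2] and
     [coef (s - k)] is zero. *)
  have [lt_mk|le_km] := ltnP m k.
    by rewrite !fund_le ?coef_le ?exprS; [ring| lia..].
  rewrite fundS //.
  have -> : (m + k.+1 - k = (m - k) + k.+1)%N; last rewrite coef_fund; first lia.
  ring.
- rewrite -[k.+1]add0n coef_fund fund_le // !coef_le; [|lia..].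
  by rewrite expr0 mulr0 subr0 sub0r.
Qed.

End FundamentalSolution.

Section ThreeTerm.
Variables (K : comNzRingType) (k : nat) (F : nat -> K).
Hypothesis k_gt0 : (0 < k)%N.
Hypothesis F_three_term :
  forall n : nat, (k <= n)%N -> F n.+1 = 2 * F n - F (n - k)%N.

Let G (n : nat) : K :=
  - F k * coef K k n.+1 + \sum_(0 <= j < k) F j * coef K k (n - j).

Let G_lt (n : nat) : (n < k)%N -> G n = 0.
Proof.
move=> lt_nk; rewrite /G coef_le // mulr0 add0r big1 // => j _.
by rewrite coef_le ?mulr0 //; lia.
Qed.

(* [G] vanishes below [k], where [F] does not: the last term stands in for the
   missing [F (n - k)]. *)
Let GS (n : nat) : (k <= n)%N ->
  G n.+1 = 2 * G n - G (n - k)%N - (if (n - k < k)%N then F (n - k)%N else 0).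
Proof.
move=> lekn.
have indic : \sum_(0 <= j < k) F j * (n - j == k)%N%:R =
    if (n - k < k)%N then F (n - k)%N else 0.
  rewrite big_mkord; case: ifP => [lt_nk|ge_nk].
    rewrite (bigD1 (Ordinal lt_nk)) //= subKn // eqxx mulr1 big1 ?addr0 // => j.
    rewrite -val_eqE /= => neq_j.
    by have /negPf -> : (n - j)%N != k; [have := ltn_ord j; lia | rewrite mulr0].
  apply: big1 => j _.
  by have /negPf -> : (n - j)%N != k; [have := ltn_ord j; lia | rewrite mulr0].
rewrite -indic /G coefS //.
have /negPf -> : n.+1 != k by lia.
have -> : (n.+1 - k = (n - k).+1)%N by lia.
have -> : \sum_(0 <= j < k) F j * coef K k (n.+1 - j) =
    2 * \sum_(0 <= j < k) F j * coef K k (n - j)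
    - \sum_(0 <= j < k) F j * coef K k (n - k - j)
    - \sum_(0 <= j < k) F j * (n - j == k)%N%:R.
  rewrite mulr_sumr -!sumrB; apply: eq_big_nat => j /andP[_ lt_jk].
  rewrite subSn ?coefS //; last by lia.
  rewrite subnAC; ring.
rewrite mulr0n; ring.
Qed.

Lemma three_term_solution (n : nat) : (k <= n)%N ->
  F n = - F k * coef K k n.+1 + \sum_(0 <= j < k) F j * coef K k (n - j).
Proof.
rewrite -/(G n); elim/ltn_ind: n => n IHn.
rewrite leq_eqVlt => /orP[/eqP <-|].
  (* At [n = k] the sum over [j] vanishes and [coef] at [k.+1] is [-1]. *)
  rewrite /G -[k.+1]add0n coef_fund fund_le // expr0 mulrN1 opprK.
  rewrite big1 ?addr0 // => j _.
  by rewrite coef_le ?mulr0 //; lia.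
case: n IHn => // n IHn lekn.
rewrite F_three_term // GS // -IHn //; case: ltnP => [lt_nk|le_kn].
  by rewrite G_lt // subr0.
by rewrite -IHn ?subr0 //; lia.
Qed.

End ThreeTerm.

(** Passing from the sum for [F n] to the sum for [F n.+1], the window of [k] terms gains [F n] and
    loses [F (n - k)]. *)
Lemma kbonacci_three_term (R : realType) (k : nat) (F : nat -> R[i]) :
  (0 < k)%N -> kbonacci_recurrence k F ->
  forall n : nat, (k <= n)%N -> F n.+1 = 2 * F n - F (n - k)%N.
Proof.
case: k => // k _ hF n lekn.
rewrite mulr2n mulrDl mul1r {2}(hF n) // hF; last by lia.
rewrite big_ltn // big_add1 [in RHS]big_nat_recr //= subn1 /=.
by rewrite addrA addrK.
Qed.

(* In every term of the sums below, the natural-number subtractions do not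
   truncate: i <= (n + 1) %/ (k + 1) gives n - i k >= i - 1 >= 0, and
   i <= (n - j) %/ (k + 1) gives n - j - 1 - i k >= i - 1 >= 0. *)
Theorem theorem4 (R : realType) (k : nat) (hk : (2 <= k)%N) (F : nat -> R[i])
    (hF : kbonacci_recurrence k F) (n : nat) (hn : (k <= n)%N) :
  F n =
    - F k * (\sum_(1 <= i < ((n + 1) %/ (k + 1)).+1)
               (-1) ^+ i * ('C(n - i * k, i - 1))%:R
                 * 2 ^+ (n + 1 - i * (k + 1)))
    + \sum_(0 <= j < k)
        \sum_(1 <= i < ((n - j) %/ (k + 1)).+1)
          (-1) ^+ i * F j * ('C(n - j - 1 - i * k, i - 1))%:R
            * 2 ^+ (n - j - i * (k + 1)).
Proof.
rewrite (three_term_solution _ (kbonacci_three_term _ hF)) //; [|lia..].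
rewrite /coef !addn1 subn1 /=; congr (_ + _).
apply: eq_bigr => j _; rewrite mulr_sumr; apply: eq_bigr => i _.
by rewrite !mulrA [F j * _]mulrC.
Qed.
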